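(* Assume the linear program $\min_{x\ge 0} c^\top x$ s.t. $Ax=b$ is feasible and bounded, and let $\mathcal Z^*$ be its set of primal-dual optimal solutions. Let $\{z^{n,k}\}$ be the iterates of restarted Halpern PDHG with the fixed frequency restart scheme, i.e. each inner loop is terminated as soon as $$k\ \ge\ \frac{2e}{\alpha_\eta}.$$ Then for every $n\ge 0$, $$\mathrm{dist}(z^{n+1,0},\mathcal Z^* )\le \left(\frac1e\right)^{n+1}\mathrm{dist}(z^{0,0},\mathcal Z^* ).$$
   Context: Let $A\in\mathbb R^{m\times d}$ be nonzero, $b\in\mathbb R^m$, $c\in\mathbb R^d$. The LP is $\min_{x\ge0}c^\top x$ s.t. $Ax=b$, with primal-dual form $\min_{x\ge 0}\max_{y} c^\top x+y^\top Ax-b^\top y$; write $z=(x,y)\in\mathbb R^{d+m}$. $\mathcal Z^*$ is the set of saddle points (primal-dual optimal solutions). $\|\cdot\|_2$ is the Euclidean norm for vectors and the spectral norm for matrices. Fix a step-size $0<\eta\le\frac{1}{2\|A\|_2}$. The PDHG operator $T(x,y)=(x^+,y^+)$ is $$x^+=\mathrm{proj}_{\mathbb R^d_+}(x-\eta A^\top y-\eta c),\qquad y^+=y+\eta A(2x^+-x)-\eta b.$$ Then $\mathcal Z^*=\{z: T(z)=z\}$. Let $P_\eta=\begin{pmatrix}\frac1\eta I&-A^\top\\-A&\frac1\eta I\end{pmatrix}$ and $\|z\|=\sqrt{\langle z,P_\eta z\rangle}$; $\mathrm{dist}(z,\mathcal U)=\inf_{u\in\mathcal U}\|z-u\|$.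 Restarted Halpern PDHG: start from $z^{0,0}$. In outer loop $n=0,1,2,\dots$, for inner counter $k=0,1,\dots$ set $$z^{n,k+1}=\frac{k+1}{k+2}T(z^{n,k})+\frac1{k+2}z^{n,0}$$ until a restart condition holds at the current $k$; then set $z^{n+1,0}=T(z^{n,k})$ with this $k$ and start outer loop $n+1$. Sharpness constant: fix $\tilde z^*\in\mathcal Z^*$ and let $R=2(\|z^{0,0}-\tilde z^*\|_2+\|\tilde z^*\|_2)$. $\alpha_\eta>0$ is a constant such that $\alpha_\eta\,\mathrm{dist}(z,\mathcal Z^* )\le\|z-T(z)\|$ for every $z$ with $\|T(z)\|_2\le R$ (such a constant exists). *)

(* Defs.v *)
From mathcomp Require Import all_boot all_order all_algebra.
From mathcomp Require Import boolp classical_sets reals.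

Set Implicit Arguments.
Unset Strict Implicit.
Unset Printing Implicit Defensive.

Import Order.TTheory GRing.Theory Num.Theory.

Local Open Scope classical_set_scope.
Local Open Scope ring_scope.

Definition dotv (R : realType) (n : nat) (u v : 'cV[R]_n) : R :=
  (u^T *m v) 0 0.

(* The norm the library puts on matrices is the sup norm, hence this separate
   Euclidean norm. *)
Definition norm2 (R : realType) (n : nat) (v : 'cV[R]_n) : R :=
  Num.sqrt (dotv v v).

Definition spectral_norm (R : realType) (m d : nat) (A : 'M[R]_(m, d)) : R :=
  sup [set norm2 (A *m v) | v in [set v : 'cV[R]_d | norm2 v <= 1]].

Definition orthant (R : realType) (d : nat) : set 'cV[R]_d :=
  [set x | forall i, 0 <= x i 0].

(* A point of [C] nearest to [v] (the nearest point when [C] is nonempty, closed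
   and convex); the default value 0 is returned only if there is none. *)
Definition proj (R : realType) (n : nat) (C : set 'cV[R]_n) (v : 'cV[R]_n) :
    'cV[R]_n :=
  xget 0 [set p | C p /\ forall q, C q -> norm2 (v - p) <= norm2 (v - q)].

Section LinearProgram.
Context {R : realType} {m d : nat}.
Variables (A : 'M[R]_(m, d)) (b : 'cV[R]_m) (c : 'cV[R]_d).

Definition lp_feasible_set : set 'cV[R]_d :=
  [set x | orthant x /\ A *m x = b].

Definition lp_feasible : Prop := exists x, lp_feasible_set x.

(* Boundedness of the optimal value; the feasible set may be unbounded. *)
Definition lp_bounded : Prop :=
  exists M : R, forall x, lp_feasible_set x -> M <= dotv c x.

Definition lagrangian (x : 'cV[R]_d) (y : 'cV[R]_m) : R :=
  dotv c x + dotv y (A *m x) - dotv b y.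

(* A primal-dual pair (x, y) is stored as the stacked vector [col_mx x y]. *)
Definition saddle_points : set 'cV[R]_(d + m) :=
  [set z | orthant (usubmx z) /\
     forall x y, orthant x ->
       lagrangian (usubmx z) y <= lagrangian (usubmx z) (dsubmx z) /\
       lagrangian (usubmx z) (dsubmx z) <= lagrangian x (dsubmx z)].

Variable eta : R.

Definition pdhg (z : 'cV[R]_(d + m)) : 'cV[R]_(d + m) :=
  let x := usubmx z in
  let y := dsubmx z in
  let x' := proj (@orthant R d) (x - eta *: (A^T *m y) - eta *: c) in
  let y' := y + eta *: (A *m (2 *: x' - x)) - eta *: b in
  col_mx x' y'.

Definition Pmx : 'M[R]_(d + m) :=
  block_mx (eta^-1)%:M (- A^T) (- A) (eta^-1)%:M.

Definition normP (z : 'cV[R]_(d + m)) : R := Num.sqrt (dotv z (Pmx *m z)).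

Definition distP (z : 'cV[R]_(d + m)) (U : set 'cV[R]_(d + m)) : R :=
  inf [set normP (z - u) | u in U].

End LinearProgram.

(* [z n k] is the k-th inner iterate of the n-th outer loop and [tau n] the inner
   counter at which that loop is left, i.e. the first k with [restart n k].  As
   the condition is tested after the k-th inner step, [z n (tau n).+1] is computed
   as well; the values [z n k] for k > (tau n).+1 are irrelevant. *)
Definition restarted_halpern (R : realType) (N : nat)
    (T : 'cV[R]_N -> 'cV[R]_N) (restart : nat -> nat -> Prop)
    (z : nat -> nat -> 'cV[R]_N) (tau : nat -> nat) : Prop :=
  forall n : nat,
    [/\ forall k : nat, (k <= tau n)%N ->
          z n k.+1 = (k.+1%:R / k.+2%:R) *: T (z n k) + k.+2%:R^-1 *: z n 0%N,
        restart n (tau n),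
        forall k : nat, (k < tau n)%N -> ~ restart n k
      & z n.+1 0%N = T (z n (tau n))].

(* Main.v *)
(* In the norm of [Pmx], PDHG is firmly nonexpansive and fixes the saddle points.
   For a nonexpansive T with residual g = id - T, the Halpern potential
   k/2 |g(z_k)|^2 + <g(z_k), z_k - z_0> stays nonpositive along the inner loop
   (multiplied by k+1 it is nonincreasing), whence |g(z_k)| <= 2/(k+1) |z_0 - u|
   for every fixed point u.  Sharpness turns this into a contraction by
   2/(alpha (k+1)) <= 1/e, provided |T(z_k)|_2 <= R.  This holds because distances
   to zstar do not increase in the norm of [Pmx], whose square lies between
   |.|_2^2 / (2 eta) and 3 |.|_2^2 / (2 eta), and sqrt 3 <= 2. *)
Require Import Defs.
From mathcomp Require Import all_boot all_order all_algebra.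
From mathcomp Require Import boolp classical_sets reals sequences exp.
From mathcomp Require Import ring lra.

Import Order.TTheory GRing.Theory Num.Theory.

Local Open Scope classical_set_scope.
Local Open Scope ring_scope.

(** * Euclidean inner product, Cauchy-Schwarz, and the spectral norm as an operator bound *)

Section DotProduct.
Context {R : realType}.

Lemma dotvE {n : nat} (u v : 'cV[R]_n) : dotv u v = \sum_i u i 0 * v i 0.
Proof. by rewrite /dotv mxE; apply: eq_bigr => i _; rewrite mxE. Qed.

Lemma dotvC {n : nat} (u v : 'cV[R]_n) : dotv u v = dotv v u.
Proof. by rewrite !dotvE; apply: eq_bigr => i _; rewrite mulrC. Qed.

Lemma dotvDl {n : nat} (u v w : 'cV[R]_n) : dotv (u + v) w = dotv u w + dotv v w.
Proof. by rewrite /dotv linearD mulmxDl mxE. Qed.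

Lemma dotvZl {n : nat} (a : R) (u v : 'cV[R]_n) : dotv (a *: u) v = a * dotv u v.
Proof. by rewrite /dotv linearZ -scalemxAl mxE. Qed.

Lemma dotvNl {n : nat} (u v : 'cV[R]_n) : dotv (- u) v = - dotv u v.
Proof. by rewrite -scaleN1r dotvZl mulN1r. Qed.

Lemma dotvDr {n : nat} (u v w : 'cV[R]_n) : dotv u (v + w) = dotv u v + dotv u w.
Proof. by rewrite dotvC dotvDl !(dotvC _ u). Qed.

Lemma dotvZr {n : nat} (a : R) (u v : 'cV[R]_n) : dotv u (a *: v) = a * dotv u v.
Proof. by rewrite dotvC dotvZl dotvC. Qed.

Lemma dotvNr {n : nat} (u v : 'cV[R]_n) : dotv u (- v) = - dotv u v.
Proof. by rewrite dotvC dotvNl dotvC. Qed.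

Definition dotv_lin {n : nat} :=
  (@dotvDl n, @dotvDr n, @dotvNl n, @dotvNr n, @dotvZl n, @dotvZr n).

Lemma dotv_mulmxr {m n : nat} (M : 'M[R]_(m, n)) (u : 'cV[R]_m) (v : 'cV[R]_n) :
  dotv u (M *m v) = dotv (M^T *m u) v.
Proof. by rewrite /dotv trmx_mul trmxK mulmxA. Qed.

Lemma dotv_col_mx {m n : nat} (x x' : 'cV[R]_m) (y y' : 'cV[R]_n) :
  dotv (col_mx x y) (col_mx x' y') = dotv x x' + dotv y y'.
Proof. by rewrite /dotv tr_col_mx mul_row_col mxE. Qed.

Lemma dotvv_ge0 {n : nat} (v : 'cV[R]_n) : 0 <= dotv v v.
Proof. by rewrite dotvE; apply: sumr_ge0 => i _; exact: sqr_ge0. Qed.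

Lemma dotvv_le0_eq0 {n : nat} (v : 'cV[R]_n) : dotv v v <= 0 -> v = 0.
Proof.
move=> le0; have /eqP : dotv v v = 0 by apply/le_anti; rewrite le0 dotvv_ge0.
rewrite dotvE psumr_eq0; last by move=> i _; exact: sqr_ge0.
move=> /allP v0; apply/matrixP => i j; rewrite (ord1 j) mxE.
by have := v0 i (mem_index_enum i); rewrite /= -expr2 sqrf_eq0 => /eqP.
Qed.

Lemma norm2_ge0 {n : nat} (v : 'cV[R]_n) : 0 <= norm2 v.
Proof. exact: sqrtr_ge0. Qed.

Lemma sqr_norm2 {n : nat} (v : 'cV[R]_n) : norm2 v ^+ 2 = dotv v v.
Proof. exact: sqr_sqrtr (dotvv_ge0 v). Qed.

Lemma norm2Z {n : nat} (a : R) (v : 'cV[R]_n) : norm2 (a *: v) = `|a| * norm2 v.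
Proof.
by rewrite /norm2 dotvZl dotvZr mulrA -expr2 sqrtrM ?sqr_ge0// sqrtr_sqr.
Qed.

Lemma norm2_0 {n : nat} : norm2 (0 : 'cV[R]_n) = 0.
Proof. by rewrite -(scale0r 0) norm2Z normr0 mul0r. Qed.

Lemma dotv_le_norm2 {n : nat} (u v : 'cV[R]_n) : dotv u v <= norm2 u * norm2 v.
Proof.
have [/eqP|u_neq0] := eqVneq (norm2 u) 0.
  rewrite sqrtr_eq0 => /dotvv_le0_eq0 ->.
  by rewrite -(scale0r 0) dotvZl mul0r mulr_ge0 ?norm2_ge0.
have u_gt0 : 0 < norm2 u by rewrite lt_def u_neq0 norm2_ge0.
have [/eqP|v_neq0] := eqVneq (norm2 v) 0.
  rewrite sqrtr_eq0 => /dotvv_le0_eq0 ->.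
  by rewrite -(scale0r 0) dotvZr mul0r mulr_ge0 ?norm2_ge0.
have v_gt0 : 0 < norm2 v by rewrite lt_def v_neq0 norm2_ge0.
(* This square equals [2 |u| |v| (|u| |v| - <u, v>)], and the positive factor [|u| |v|] can be
   divided out. *)
have := dotvv_ge0 (norm2 v *: u - norm2 u *: v).
rewrite !dotv_lin (dotvC v u) -!sqr_norm2 => sq_ge0.
rewrite -subr_ge0 -(pmulr_rge0 _ (mulr_gt0 u_gt0 v_gt0)); nra.
Qed.

Lemma normr_dotv_le {n : nat} (u v : 'cV[R]_n) :
  `|dotv u v| <= norm2 u * norm2 v.
Proof.
rewrite ler_norml dotv_le_norm2 andbT lerNl -dotvNl.
apply: le_trans (dotv_le_norm2 _ _) _.
by rewrite -scaleN1r norm2Z normrN1 mul1r.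
Qed.

Lemma ler_norm2D {n : nat} (u v : 'cV[R]_n) : norm2 (u + v) <= norm2 u + norm2 v.
Proof.
rewrite -(@ler_pXn2r _ 2) ?nnegrE ?addr_ge0 ?norm2_ge0//.
rewrite sqr_norm2 !dotv_lin (dotvC v u) -!sqr_norm2.
have := dotv_le_norm2 u v; lra.
Qed.

(** Cauchy-Schwarz row by row. This crude constant bounds the set whose supremum is [spectral_norm];
    without a bound, [sup] would not be known to dominate that set. *)
Lemma norm2_mulmx_le_frobenius {m n : nat} (M : 'M[R]_(m, n)) (v : 'cV[R]_n) :
  norm2 (M *m v) <= Num.sqrt (\sum_i norm2 (row i M)^T ^+ 2) * norm2 v.
Proof.
rewrite -(@ler_pXn2r _ 2) ?nnegrE ?norm2_ge0 ?mulr_ge0 ?norm2_ge0 ?sqrtr_ge0//.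
rewrite sqr_norm2 exprMn sqr_sqrtr;
  last by apply: sumr_ge0 => i _; exact: sqr_ge0.
rewrite dotvE mulr_suml; apply: ler_sum => i _.
have -> : (M *m v) i 0 = dotv (row i M)^T v by rewrite /dotv trmxK -row_mul [RHS]mxE.
have := normr_dotv_le (row i M)^T v; rewrite ler_norml => /andP[].
set D := dotv _ _ => ? ?.
rewrite -exprMn; nra.
Qed.

Lemma norm2_mulmx_le_spectral {m n : nat} (M : 'M[R]_(m, n)) (v : 'cV[R]_n) :
  norm2 (M *m v) <= spectral_norm M * norm2 v.
Proof.
have [/eqP|v_neq0] := eqVneq (norm2 v) 0.
  rewrite sqrtr_eq0 => /dotvv_le0_eq0 ->.
  by rewrite mulmx0 !norm2_0 mulr0.
have v_gt0 : 0 < norm2 v by rewrite lt_def v_neq0 norm2_ge0.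
have vV_ge0 : 0 <= (norm2 v)^-1 by rewrite invr_ge0 norm2_ge0.
rewrite -ler_pdivrMr// mulrC -(ger0_norm vV_ge0) -norm2Z scalemxAr; apply: ub_le_sup.
  exists (Num.sqrt (\sum_i norm2 (row i M)^T ^+ 2)) => _ [w /= w_le1 <-].
  apply: le_trans (norm2_mulmx_le_frobenius _ _) _.
  by rewrite ler_piMr ?sqrtr_ge0.
exists ((norm2 v)^-1 *: v) => //=.
by rewrite norm2Z ger0_norm// mulVf.
Qed.

End DotProduct.

Lemma natr1_neq0 {R : realType} (k : nat) : k%:R + 1 != 0 :> R.
Proof. by rewrite natr1 pnatr_eq0. Qed.

(** * Halpern iteration of a map that is nonexpansive in a semidefinite form *)

Section Form.
Context {R : realType} {N : nat}.
Variable M : 'M[R]_N.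
Hypothesis M_sym : M^T = M.

(** For [M := Pmx A eta], [normP] is the square root of [form v v]; working with squares keeps the
    estimates polynomial. *)
Definition form (u v : 'cV[R]_N) : R := dotv u (M *m v).

Lemma formC (u v : 'cV[R]_N) : form u v = form v u.
Proof. by rewrite /form dotv_mulmxr M_sym dotvC. Qed.

Lemma formDl (u v w : 'cV[R]_N) : form (u + v) w = form u w + form v w.
Proof. exact: dotvDl. Qed.

Lemma formDr (u v w : 'cV[R]_N) : form u (v + w) = form u v + form u w.
Proof. by rewrite /form mulmxDr dotvDr. Qed.

Lemma formNl (u v : 'cV[R]_N) : form (- u) v = - form u v.
Proof. exact: dotvNl. Qed.

Lemma formNr (u v : 'cV[R]_N) : form u (- v) = - form u v.
Proof. by rewrite /form mulmxN dotvNr. Qed.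

Lemma formZl (a : R) (u v : 'cV[R]_N) : form (a *: u) v = a * form u v.
Proof. exact: dotvZl. Qed.

Lemma formZr (a : R) (u v : 'cV[R]_N) : form u (a *: v) = a * form u v.
Proof. by rewrite /form -scalemxAr dotvZr. Qed.

Definition form_lin := (formDl, formDr, formNl, formNr, formZl, formZr).

Hypothesis M_psd : forall v : 'cV[R]_N, 0 <= form v v.

Variables (T : 'cV[R]_N -> 'cV[R]_N) (z : nat -> 'cV[R]_N) (K : nat).
Hypothesis T_nonexp : forall u v,
  form (T u - T v) (T u - T v) <= form (u - v) (u - v).
Hypothesis z_halpern : forall k, (k < K)%N ->
  z k.+1 = (k.+1%:R / k.+2%:R) *: T (z k) + k.+2%:R^-1 *: z 0%N.

(** With [e = u - v] and [g] the difference of the residuals, [T u - T v = e - g]; expanding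
    [|e - g|^2 <= |e|^2] gives the claim. *)
Lemma residual_cocoercive (u v : 'cV[R]_N) :
  form ((u - T u) - (v - T v)) ((u - T u) - (v - T v))
    <= 2 * form ((u - T u) - (v - T v)) (u - v).
Proof.
set g := (u - T u) - (v - T v).
have := T_nonexp u v.
have -> : T u - T v = (u - v) - g by rewrite /g; apply/matrixP=> i j; rewrite !mxE; ring.
move: (u - v) g => e g'; rewrite !form_lin (formC e g'); lra.
Qed.

Lemma halpern_potential (k : nat) : (k <= K)%N ->
  k%:R / 2 * form (z k - T (z k)) (z k - T (z k))
    + form (z k - T (z k)) (z k - z 0%N) <= 0.
Proof.
elim: k => [_|k IHk k_lt].
  by rewrite !mul0r subrr add0r -(scale0r 0) formZr mul0r.
have {}IHk := IHk (ltnW k_lt).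
have := residual_cocoercive (z k.+1) (z k).
move: IHk; set a := z k.+1 - T _; set g := z k - T _; set w := z k - z 0%N.
(* Since [T (z k) - z 0 = w - g], both displacements of the new iterate are combinations of [w] and
   [g]; the claim becomes linear in five inner products. *)
have w' : z k.+1 - z 0%N = (k.+1%:R / k.+2%:R) *: (w - g).
  rewrite z_halpern// /w /g -(natr1 k.+1).
  have := @natr1_neq0 R k.+1; move: k.+1%:R => t t_neq0.
  by apply/matrixP => i j; rewrite !mxE; field.
have -> : z k.+1 - z k = - (k.+2%:R^-1 *: (w + k.+1%:R *: g)).
  have -> : z k.+1 - z k = (z k.+1 - z 0%N) - w.
    by rewrite /w; apply/matrixP=> i j; rewrite !mxE; ring.
  rewrite w' -(natr1 k.+1).
  have := @natr1_neq0 R k.+1; move: k.+1%:R => t t_neq0.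
  by apply/matrixP => i j; rewrite !mxE; field.
rewrite w'; move: a g w {w'} => a g w; rewrite !form_lin (formC g a).
move: (form a a) (form a g) (form g g) (form a w) (form g w) => aa ag gg aw gw.
have k_ge0 : 0 <= k%:R :> R by rewrite ler0n.
have -> : k.+2%:R = k%:R + 2 :> R by rewrite -addn2 natrD.
have -> : k.+1%:R = k%:R + 1 :> R by rewrite -addn1 natrD.
move: (k%:R : R) k_ge0 => x x_ge0 pot coco.
have x2_neq0 : x + 2 != 0 by rewrite gt_eqF//; lra.
have {}coco : (x + 2) / 2 * (aa - ag - (ag - gg))
    + (aw - gw + (x + 1) * (ag - gg)) <= 0.
  move: coco; rewrite -subr_ge0 => coco.
  (* With this weight, cocoercivity is the monotonicity of the scaled potential. *)
  have x2_ge0 : 0 <= (x + 2) / 2 by lra.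
  have := mulr_ge0 x2_ge0 coco; rewrite -oppr_le0.
  by apply: le_trans; rewrite le_eqVlt; apply/orP; left; apply/eqP; field.
(* Once the positive factor is removed, what remains is exactly the sum of the left-hand sides of
   [pot] and [coco]. *)
have -> : (x + 1) / 2 * aa + (x + 1) / (x + 2) * (aw - ag)
    = (x + 1) / (x + 2) * ((x + 2) / 2 * aa + aw - ag) by field.
rewrite pmulr_rle0; last by rewrite divr_gt0//; lra.
lra.
Qed.

(** Cocoercivity against the fixed point turns the coefficient [k/2] of the potential into
    [(k+1)/2]: together they give [(k+1)/2 |g|^2 <= <g, z 0 - u>]. *)
Lemma halpern_residual (k : nat) (u : 'cV[R]_N) : (k <= K)%N -> T u = u ->
  (k.+1%:R / 2) ^+ 2 * form (z k - T (z k)) (z k - T (z k))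
    <= form (z 0%N - u) (z 0%N - u).
Proof.
move=> kK Tu; have pot := halpern_potential k kK.
have := residual_cocoercive (z k) u; rewrite Tu subrr subr0.
move: pot; set g := z k - T _.
have -> : z k - z 0%N = (z k - u) - (z 0%N - u).
  by apply/matrixP=> i j; rewrite !mxE; ring.
move: (z k - u) (z 0%N - u) g => e w g pot coco.
(* Nonnegativity of this square replaces Cauchy-Schwarz. *)
have := M_psd (w - (k.+1%:R / 2) *: g).
rewrite -natr1; move: pot coco; rewrite !form_lin (formC w g).
have : 0 <= k%:R :> R by rewrite ler0n.
move: (form _ _) (form _ _) (form _ _) (form _ _) (k%:R : R) => a1 a2 a3 a4 x.
nra.
Qed.

(** Each new iterate is a convex combination of [T (z k)] and [z 0], both in the ball about [u]
    through [z 0]. *)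
Lemma halpern_dist (k : nat) (u : 'cV[R]_N) : (k <= K)%N -> T u = u ->
  form (z k - u) (z k - u) <= form (z 0%N - u) (z 0%N - u).
Proof.
move=> + Tu; elim: k => [//|k IHk k_lt]; have {}IHk := IHk (ltnW k_lt).
have := T_nonexp (z k) u; rewrite Tu z_halpern// => Tz.
have -> : (k.+1%:R / k.+2%:R) *: T (z k) + k.+2%:R^-1 *: z 0%N - u
    = (z 0%N - u) + (k.+1%:R / k.+2%:R) *: ((T (z k) - u) - (z 0%N - u)).
  rewrite -(natr1 k.+1).
  have := @natr1_neq0 R k.+1; move: k.+1%:R => t t_neq0.
  by apply/matrixP => i j; rewrite !mxE; field.
have l_ge0 : 0 <= k.+1%:R / k.+2%:R :> R by rewrite divr_ge0 ?ler0n.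
have l_le1 : k.+1%:R / k.+2%:R <= 1 :> R.
  by rewrite ler_pdivrMr ?ltr0n// mul1r ler_nat.
have := M_psd ((T (z k) - u) - (z 0%N - u)).
have {IHk Tz} := le_trans Tz IHk.
move: (T _ - u) (z 0%N - u) (k.+1%:R / k.+2%:R) l_ge0 l_le1 => a w l l_ge0 l_le1.
rewrite !form_lin (formC w a).
move: (form _ _) (form _ _) (form _ _) => aw ww aa aa_le D_ge0.
have l'_ge0 : 0 <= 1 - l by rewrite subr_ge0.
(* Convexity of the square: [|w + l (a - w)|^2 = (1 - l) |w|^2 + l |a|^2 - l (1 - l) |a - w|^2]. *)
have := mulr_ge0 (mulr_ge0 l_ge0 l'_ge0) D_ge0.
rewrite -subr_ge0 in aa_le; have := mulr_ge0 l_ge0 aa_le.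
nra.
Qed.

End Form.

(** * Projection onto the orthant through its variational inequality *)

Section Projection.
Context {R : realType} {n : nat}.

Lemma proj_unique (C : set 'cV[R]_n) (v p : 'cV[R]_n) :
  C p -> (forall q, C q -> dotv (v - p) (q - p) <= 0) -> proj C v = p.
Proof.
move=> Cp vi.
have expand q : dotv (v - q) (v - q)
    = dotv (v - p) (v - p) + dotv (q - p) (q - p) - 2 * dotv (v - p) (q - p).
  have -> : v - q = (v - p) - (q - p) by apply/matrixP=> i j; rewrite !mxE; ring.
  move: (v - p) (q - p) => a e; rewrite !dotv_lin (dotvC e a); ring.
rewrite /proj; case: xgetP => [_ -> [Cq q_near]|none].
  have := q_near p Cp; have := vi _ Cq.
  rewrite ler_sqrt ?dotvv_ge0// expand => vi_q near.
  apply/eqP; rewrite -subr_eq0; apply/eqP/dotvv_le0_eq0; lra.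
(* The point [p] is itself nearest, so the default value of [xget] is never returned. *)
exfalso; apply: (none p); split=> // q Cq.
rewrite ler_sqrt ?dotvv_ge0// (expand q).
have := vi q Cq; have := dotvv_ge0 (q - p); lra.
Qed.

(** The projection is the positive part. In each coordinate either the residual vanishes, or it is
    nonpositive and multiplies [q i 0 >= 0]. *)
Lemma proj_orthantP (v : 'cV[R]_n) :
  orthant (proj (@orthant R n) v) /\
  forall q, orthant q ->
    dotv (v - proj (@orthant R n) v) (q - proj (@orthant R n) v) <= 0.
Proof.
pose p : 'cV[R]_n := \col_i Num.max (v i 0) 0.
have Cp : orthant p by move=> i; rewrite mxE le_max lexx orbT.
have vi q : orthant q -> dotv (v - p) (q - p) <= 0.
  move=> Cq; rewrite dotvE; apply: sumr_le0 => i _; rewrite !mxE.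
  have q0 := Cq i; case: (leP (v i 0) 0) => [v0|_]; last by rewrite subrr mul0r.
  by rewrite !subr0 mulr_le0_ge0.
by have -> := proj_unique _ v p Cp vi.
Qed.

End Projection.

(** * PDHG in the geometry of [Pmx]: fixed points, firm nonexpansiveness, comparison of norms *)

Section Pdhg.
Context {R : realType} {m d : nat}.
Variables (A : 'M[R]_(m, d)) (b : 'cV[R]_m) (c : 'cV[R]_d) (eta : R).
Hypothesis eta_gt0 : 0 < eta.

Lemma Pmx_sym : (Pmx A eta)^T = Pmx A eta.
Proof. by rewrite tr_block_mx !tr_scalar_mx !linearN /= trmxK. Qed.

Lemma form_Pmx (x x' : 'cV[R]_d) (y y' : 'cV[R]_m) :
  form (Pmx A eta) (col_mx x y) (col_mx x' y')
    = eta^-1 * (dotv x x' + dotv y y') - dotv y (A *m x') - dotv y' (A *m x).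
Proof.
rewrite /form mul_block_col !mul_scalar_mx dotv_col_mx !mulNmx !dotv_lin.
rewrite (dotv_mulmxr A^T) trmxK (dotvC (A *m x)); ring.
Qed.

Lemma pdhg_saddle (u : 'cV[R]_(d + m)) :
  saddle_points A b c u -> pdhg A b c eta u = u.
Proof.
rewrite -[u]vsubmxK; move: (usubmx u) (dsubmx u) => x y.
rewrite /saddle_points /= /pdhg col_mxKu col_mxKd => -[x_ge0 saddle].
have Axb : A *m x = b.
  (* Moving the multiplier along the constraint violation raises the Lagrangian by [|A x - b|^2],
     which optimality in [y] forces to be 0. *)
  have [+ _] := saddle x (y + (A *m x - b)) x_ge0.
  move=> max_y; apply/eqP; rewrite -subr_eq0; apply/eqP/dotvv_le0_eq0.
  move: max_y; rewrite /lagrangian !dotv_lin (dotvC b (A *m x)); lra.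
have -> : proj (@orthant R d) (x - eta *: (A^T *m y) - eta *: c) = x.
  apply: proj_unique => // q q_ge0.
  have -> : x - eta *: (A^T *m y) - eta *: c - x = - (eta *: (c + A^T *m y)).
    by apply/matrixP=> i j; rewrite !mxE; ring.
  rewrite dotvNl dotvZl oppr_le0 mulr_ge0 ?(ltW eta_gt0)//.
  (* Optimality in [x] reads [<c + A^T y, q - x> >= 0], the variational inequality of the
     projection. *)
  have [_] := saddle q y q_ge0.
  rewrite /lagrangian !dotv_mulmxr !dotv_lin; lra.
congr col_mx; rewrite mulmxBr -scalemxAr Axb.
by apply/matrixP=> i j; rewrite !mxE; ring.
Qed.

(** The variational inequalities of the two projections, each tested at the other projection, add up
    to [0 <= <e - eta A^T w - q, q>]. The extrapolation [2 x' - x] makes the remaining dual terms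
    cancel, so the form is [eta^-1] times this quantity. *)
Lemma form_pdhg_firm (u v : 'cV[R]_(d + m)) :
  0 <= form (Pmx A eta) ((u - v) - (pdhg A b c eta u - pdhg A b c eta v))
         (pdhg A b c eta u - pdhg A b c eta v).
Proof.
rewrite -[u]vsubmxK -[v]vsubmxK.
move: (usubmx u) (dsubmx u) (usubmx v) (dsubmx v) => x1 y1 x2 y2.
rewrite /pdhg !col_mxKu !col_mxKd.
have := proj_orthantP (x1 - eta *: (A^T *m y1) - eta *: c).
have := proj_orthantP (x2 - eta *: (A^T *m y2) - eta *: c).
move: (proj _ _) (proj _ _) => p1 p2 [p2_ge0 vi2] [p1_ge0 vi1].
have {}vi1 := vi1 _ p2_ge0; have {}vi2 := vi2 _ p1_ge0.
set e := x1 - x2; set q := p1 - p2; set w := y1 - y2.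
have -> : col_mx x1 y1 - col_mx x2 y2 = col_mx e w.
  by rewrite opp_col_mx add_col_mx.
have -> : col_mx p1 (y1 + eta *: (A *m (2 *: p1 - x1)) - eta *: b)
    - col_mx p2 (y2 + eta *: (A *m (2 *: p2 - x2)) - eta *: b)
    = col_mx q (w + eta *: (2 *: (A *m q) - A *m e)).
  rewrite opp_col_mx add_col_mx /q /e !mulmxBr -!scalemxAr.
  by congr col_mx; apply/matrixP=> i j; rewrite !mxE; ring.
have {vi1 vi2} : 0 <= dotv (e - eta *: (A^T *m w) - q) q.
  move: vi1 vi2; rewrite /e /q /w mulmxBr !dotv_lin; lra.
move: e q w => e q w; rewrite opp_col_mx add_col_mx form_Pmx.
rewrite mulmxBr !dotv_lin -dotv_mulmxr (dotvC (A *m q) w) (dotvC (A *m e) w).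
rewrite (dotvC (A *m e) (A *m q)) -(pmulr_rge0 _ (_ : 0 < eta^-1)) ?invr_gt0//.
move/le_trans; apply; rewrite le_eqVlt; apply/orP; left; apply/eqP.
by field; rewrite gt_eqF.
Qed.

Hypothesis eta_le : eta <= 1 / (2 * spectral_norm A).

Lemma spectral_norm_le : 2 * spectral_norm A <= eta^-1.
Proof.
(* As the inverse of 0 is 0, a positive [eta] below [1 / (2 * spectral_norm A)] forces the
   denominator to be positive. *)
have s_gt0 : 0 < 2 * spectral_norm A.
  by have := lt_le_trans eta_gt0 eta_le; rewrite div1r invr_gt0.
by rewrite -[leLHS]invrK lef_pV2 ?posrE ?invr_gt0// -div1r.
Qed.

(** The cross term satisfies [2 |<y, A x>| <= eta^-1 |x| |y| <= (|x|^2 + |y|^2) / (2 eta)], half of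
    the diagonal term. *)
Lemma form_Pmx_bounds (v : 'cV[R]_(d + m)) :
  norm2 v ^+ 2 / (2 * eta) <= form (Pmx A eta) v v <= 3 * norm2 v ^+ 2 / (2 * eta).
Proof.
rewrite sqr_norm2 -[v]vsubmxK; move: (usubmx v) (dsubmx v) => x y.
rewrite form_Pmx dotv_col_mx invfM mulrA (mulrA _ _ (eta^-1)).
have := normr_dotv_le y (A *m x); have := norm2_mulmx_le_spectral A x.
rewrite ler_norml -!sqr_norm2; have := spectral_norm_le.
have := norm2_ge0 x; have := norm2_ge0 y.
have : 0 <= eta^-1 by rewrite invr_ge0 ltW.
move: (norm2 x) (norm2 y) (norm2 (A *m x)) (dotv y (A *m x)) (eta^-1) (spectral_norm A).
move=> nx ny nAx D e s e_ge0 ny_ge0 nx_ge0 s_le nAx_le /andP[D_ge D_le].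
have {}nAx_le : ny * nAx <= ny * (e / 2 * nx).
  apply: ler_wpM2l => //; apply: le_trans nAx_le _; apply: ler_wpM2r => //; lra.
have := mulr_ge0 e_ge0 (sqr_ge0 (nx - ny)).
move=> sq_ge0; apply/andP; split; nra.
Qed.

Lemma form_Pmx_ge0 (v : 'cV[R]_(d + m)) : 0 <= form (Pmx A eta) v v.
Proof.
have /andP[+ _] := form_Pmx_bounds v; apply: le_trans.
by rewrite divr_ge0 ?sqr_ge0// mulr_ge0// ltW.
Qed.

(** Expand [|a|^2 = |a - e|^2 + 2 <a - e, e> + |e|^2]; firmness makes the middle term
    nonnegative. *)
Lemma form_pdhg_nonexpansive (u v : 'cV[R]_(d + m)) :
  form (Pmx A eta) (pdhg A b c eta u - pdhg A b c eta v)
      (pdhg A b c eta u - pdhg A b c eta v)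
    <= form (Pmx A eta) (u - v) (u - v).
Proof.
have := form_pdhg_firm u v.
have := form_Pmx_ge0 ((u - v) - (pdhg A b c eta u - pdhg A b c eta v)).
move: (u - v) (_ - pdhg _ _ _ _ v) => a e.
rewrite !form_lin (formC _ Pmx_sym e a); lra.
Qed.

End Pdhg.

(** * Distance to a set as an infimum, bounded point by point *)

Section Distance.
Context {R : realType} {m d : nat}.
Variables (A : 'M[R]_(m, d)) (eta : R) (U : set 'cV[R]_(d + m)).

Lemma distP_le (w u : 'cV[R]_(d + m)) : U u -> distP A eta w U <= normP A eta (w - u).
Proof.
move=> Uu; apply: ge_inf; last by exists u.
by exists 0 => _ [v _ <-]; exact: sqrtr_ge0.
Qed.

Lemma distP_ge (w : 'cV[R]_(d + m)) (r : R) : U !=set0 ->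
  (forall u, U u -> r <= normP A eta (w - u)) -> r <= distP A eta w U.
Proof.
move=> [u0 Uu0] r_le; apply: lb_le_inf; first by exists (normP A eta (w - u0)), u0.
by move=> _ [u Uu <-]; exact: r_le.
Qed.

Lemma distP_ge0 (w : 'cV[R]_(d + m)) : U !=set0 -> 0 <= distP A eta w U.
Proof. by move=> U0; apply: distP_ge => // u _; exact: sqrtr_ge0. Qed.

End Distance.

Theorem theorem1 (R : realType) (m d : nat)
    (A : 'M[R]_(m, d)) (b : 'cV[R]_m) (c : 'cV[R]_d)
    (eta alpha : R) (zstar : 'cV[R]_(d + m))
    (z : nat -> nat -> 'cV[R]_(d + m)) (tau : nat -> nat)
    (A_neq0 : A != 0)
    (feasible : lp_feasible A b)
    (bounded : lp_bounded A b c)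
    (eta_gt0 : 0 < eta)
    (eta_le : eta <= 1 / (2 * spectral_norm A))
    (zstar_opt : saddle_points A b c zstar)
    (alpha_gt0 : 0 < alpha)
    (sharp : forall w : 'cV[R]_(d + m),
       norm2 (pdhg A b c eta w) <= 2 * (norm2 (z 0%N 0%N - zstar) + norm2 zstar) ->
       alpha * distP A eta w (saddle_points A b c)
         <= normP A eta (w - pdhg A b c eta w))
    (run : restarted_halpern (pdhg A b c eta)
       (fun _ k : nat => 2 * expR 1 / alpha <= k%:R) z tau) :
  forall n : nat,
    distP A eta (z n.+1 0%N) (saddle_points A b c)
      <= (1 / expR 1) ^+ n.+1 * distP A eta (z 0%N 0%N) (saddle_points A b c).
Proof.
set T := pdhg A b c eta; set Z := saddle_points A b c.
have Z_neq0 : Z !=set0 by exists zstar.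
have P_sym := Pmx_sym A eta.
have P_ge0 := form_Pmx_ge0 A eta eta_gt0 eta_le.
have T_nonexp := form_pdhg_nonexpansive A b c eta eta_gt0 eta_le.
have fixT u : Z u -> T u = u by exact: pdhg_saddle.
have in_ball w : form (Pmx A eta) (w - zstar) (w - zstar)
      <= form (Pmx A eta) (z 0%N 0%N - zstar) (z 0%N 0%N - zstar) ->
    norm2 w <= 2 * (norm2 (z 0%N 0%N - zstar) + norm2 zstar).
  move=> w_le.
  have /andP[lo _] := form_Pmx_bounds A eta eta_gt0 eta_le (w - zstar).
  have /andP[_ up] := form_Pmx_bounds A eta eta_gt0 eta_le (z 0%N 0%N - zstar).
  have := le_trans lo (le_trans w_le up).
  rewrite ler_pM2r ?invr_gt0 ?mulr_gt0// => sq_le.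
  have : norm2 (w - zstar) <= 2 * norm2 (z 0%N 0%N - zstar).
    rewrite -(@ler_pXn2r _ 2) ?nnegrE ?mulr_ge0 ?norm2_ge0//.
    rewrite exprMn; have := sqr_ge0 (norm2 (z 0%N 0%N - zstar)); lra.
  have := ler_norm2D (w - zstar) zstar; rewrite subrK.
  have := norm2_ge0 zstar; lra.
have step n (w := z n (tau n)) :
    form (Pmx A eta) (z n 0%N - zstar) (z n 0%N - zstar)
      <= form (Pmx A eta) (z 0%N 0%N - zstar) (z 0%N 0%N - zstar) ->
  form (Pmx A eta) (z n.+1 0%N - zstar) (z n.+1 0%N - zstar)
      <= form (Pmx A eta) (z 0%N 0%N - zstar) (z 0%N 0%N - zstar)
  /\ expR 1 * distP A eta (z n.+1 0%N) Z <= distP A eta (z n 0%N) Z.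
  move=> z0_le; have [halpern stop _ ->] := run n; rewrite -/w.
  have Tw_le : form (Pmx A eta) (T w - zstar) (T w - zstar)
      <= form (Pmx A eta) (z 0%N 0%N - zstar) (z 0%N 0%N - zstar).
    rewrite -[X in T w - X](fixT zstar)//; apply: le_trans (T_nonexp _ _) _.
    apply: le_trans z0_le.
    (* The recursion holds for [k <= tau n], hence the strict horizon [(tau n).+1]. *)
    exact: (halpern_dist _ P_sym P_ge0 T (z n) (tau n).+1 T_nonexp
      halpern _ _ (leqnSn _) (fixT _ zstar_opt)).
  split=> //.
  have Tw_dist : distP A eta (T w) Z <= distP A eta w Z.
    apply: distP_ge => // u Zu; apply: le_trans (distP_le _ _ _ _ _ Zu) _.
    by rewrite -{1}(fixT u Zu) ler_sqrt ?P_ge0// T_nonexp.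
  (* Sharpness at [w], then the Halpern rate against an arbitrary saddle point [u]; the infimum over
     [u] is taken last. *)
  have dist_le : (tau n).+1%:R / 2 * alpha * distP A eta w Z <= distP A eta (z n 0%N) Z.
    apply: distP_ge => // u Zu.
    rewrite -mulrA.
    have h_ge0 : 0 <= (tau n).+1%:R / 2 :> R by rewrite divr_ge0.
    apply: le_trans (ler_wpM2l h_ge0 (sharp w (in_ball _ Tw_le))) _.
    rewrite -(ger0_norm h_ge0) -sqrtr_sqr -sqrtrM ?sqr_ge0// ler_sqrt ?P_ge0//.
    exact: (halpern_residual _ P_sym P_ge0 T (z n) (tau n).+1 T_nonexp
      halpern _ _ (leqnSn _) (fixT _ Zu)).
  apply: le_trans dist_le; have e_gt0 := expR_gt0 (1 : R).
  apply: le_trans (ler_wpM2l (ltW e_gt0) Tw_dist) _.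
  apply: ler_wpM2r; first exact: distP_ge0.
  (* The restart test gives [2 e <= alpha k]; its factor 2 absorbs the [1/2] of the Halpern rate, so
     [e <= (k+1)/2 * alpha]. *)
  move: stop; rewrite ler_pdivrMr// -(natr1 (tau n)); nra.
have z0_le : forall n, form (Pmx A eta) (z n 0%N - zstar) (z n 0%N - zstar)
      <= form (Pmx A eta) (z 0%N 0%N - zstar) (z 0%N 0%N - zstar).
  by elim=> [//|n /step[]].
have contract n : distP A eta (z n.+1 0%N) Z <= 1 / expR 1 * distP A eta (z n 0%N) Z.
  by rewrite div1r ler_pdivlMl ?expR_gt0//; have [] := step n (z0_le n).
elim=> [|n IHn]; first by rewrite expr1.
apply: le_trans (contract n.+1) _; rewrite exprS -[leRHS]mulrA.
by apply: ler_wpM2l => //; rewrite divr_ge0// expR_ge0.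
Qed.
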